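(* Let $V\in C^\infty(\mathbb R,\mathbb R)$ and assume there exist $\eta,\alpha>0$ and $L_0\ge 1$ such that $V(q)\ge \eta|q|^\alpha$ for all $|q|\ge L_0$. Put $I(p,q)=p^2+2V(q)$ for $p,q\in\mathbb R$ and $Z_0=-2\inf_{q\in\mathbb R}V(q)$. Then for every $\nu>0$ the family $\{\mu_{\nu,\epsilon}\}_{\epsilon>0}$ satisfies a large deviations principle on $\mathbb R^2$ as $\epsilon\to0$ with the good rate function $\nu(I+Z_0)$, i.e., $\nu(I+Z_0)$ is a good rate function and $$\liminf_{\epsilon\to0}\epsilon\ln\mu_{\nu,\epsilon}(U)\ge-\inf_{(p,q)\in U}\nu\big(I(p,q)+Z_0\big)\quad\text{for every open } U\subseteq\mathbb R^2,$$ $$\limsup_{\epsilon\to0}\epsilon\ln\mu_{\nu,\epsilon}(C)\le-\inf_{(p,q)\in C}\nu\big(I(p,q)+Z_0\big)\quad\text{for every closed } C\subseteq\mathbb R^2.$$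
   Context: For $\nu,\epsilon>0$, $\mu_{\nu,\epsilon}$ is the Borel probability measure on $\mathbb R^2$ given by $d\mu_{\nu,\epsilon}=\frac{1}{Z_{\nu,\epsilon}}\exp\{-\frac{2\nu}{\epsilon}(\frac12p^2+V(q))\}\,dp\,dq$, where $Z_{\nu,\epsilon}=\int_{\mathbb R^2}e^{-\frac{2\nu}{\epsilon}(\frac12p^2+V(q))}\,dp\,dq$. It is the unique invariant measure of the Langevin equation $dP=-\nabla V(Q)\,dt-\nu P\,dt+\sqrt\epsilon\,dW$, $dQ=P\,dt$, with $W$ a one-dimensional standard Wiener process. A rate function is a lower semicontinuous map from the space to $[0,\infty]$; it is good if all its level sets $\{x: I(x)\le a\}$, $a\in[0,\infty)$, are compact. Conventions: $\ln 0=-\infty$, $\inf\emptyset=+\infty$. *)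

(* Defs.v *)
From HB Require Import structures.
From mathcomp Require Import all_boot all_order all_algebra.
From mathcomp Require Import all_classical all_reals all_analysis.
Set Implicit Arguments.
Unset Strict Implicit.
Unset Printing Implicit Defensive.
Import Order.TTheory GRing.Theory Num.Theory.
Import numFieldNormedType.Exports.
Local Open Scope classical_set_scope.
Local Open Scope ring_scope.

Definition smooth (R : realType) (V : R -> R) : Prop :=
  forall (n : nat) (x : R), derivable (derive1n n V) x 1.

Definition rate_function (R : realType) (T : topologicalType)
    (J : T -> \bar R) : Prop :=
  (forall x, (0 <= J x)%E) /\ lower_semicontinuous J.

Definition good_rate_function (R : realType) (T : topologicalType)
    (J : T -> \bar R) : Prop :=
  rate_function J /\
  forall a : R, 0 <= a -> compact [set x | (J x <= a%:E)%E].

(* [lne] and [ereal_inf] already follow the conventions [ln 0 = -oo] and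
   [inf set0 = +oo]; the parameter [eps] tends to [0] through positive values *)
Definition satisfies_LDP (R : realType) (T : topologicalType)
    (mu : R -> set T -> \bar R) (J : T -> \bar R) : Prop :=
  [/\ good_rate_function J,
      (forall U : set T, open U ->
        (- ereal_inf (J @` U) <=
         limf_einf (fun eps : R => eps%:E * lne (mu eps U)) (0:R)^'+)%E) &
      (forall C : set T, closed C ->
        (limf_esup (fun eps : R => eps%:E * lne (mu eps C)) (0:R)^'+ <=
         - ereal_inf (J @` C))%E)].

(* points of the phase space are pairs (momentum, position) = (p, q) *)
Definition gibbs_density (R : realType) (V : R -> R) (nu eps : R)
    (z : R * R) : R :=
  expR (- (2 * nu / eps) * (2^-1 * z.1 ^+ 2 + V z.2)).

Definition gibbs_mass (R : realType) (V : R -> R) (nu eps : R)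
    (A : set (R * R)) : \bar R :=
  \int[(@lebesgue_measure R \x @lebesgue_measure R)%E]_(z in A)
    (gibbs_density V nu eps z)%:E.

Definition gibbs_measure (R : realType) (V : R -> R) (nu eps : R)
    (A : set (R * R)) : \bar R :=
  (gibbs_mass V nu eps A / gibbs_mass V nu eps setT)%E.

Definition energy (R : realType) (V : R -> R) (z : R * R) : R :=
  z.1 ^+ 2 + 2 * V z.2.

Definition Z0 (R : realType) (V : R -> R) : R := - 2 * inf (range V).

(* Main.v *)
Require Import Defs.
From mathcomp Require Import all_boot all_order all_algebra.
From mathcomp Require Import all_classical all_reals all_analysis.
From mathcomp Require Import measurable_realfun ring lra.
Import Order.TTheory GRing.Theory Num.Theory.
Import numFieldNormedType.Exports.
Local Open Scope classical_set_scope.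
Local Open Scope ring_scope.

Set Implicit Arguments.
Unset Strict Implicit.
Unset Printing Implicit Defensive.

(** The argument is Laplace's method. Write [H] for [energy V], [m] for its
infimum [- Z0 V], and [beta = nu / eps], so that the unnormalised density is
[exp (- beta H)] and [beta] tends to infinity as [eps] tends to [0].

- If [H >= h] on [A], then [beta H >= (beta - 1) h + H] there, so the mass of
  [A] is at most [exp (- (beta - 1) h)] times the finite constant given by the
  integral of [exp (- H)] ([gibbs_mass_le]).
- If [U] is open and contains a point with [H < c], then [U] contains a box of
  fixed positive area on which [H < c], so the mass of [U] is at least
  [exp (- beta c)] times that area ([gibbs_mass_ge]).

The partition function is the mass of the whole plane, to which both bounds
apply with [h = m] and with [c] slightly above [m]. Dividing, taking logarithms
and multiplying by [eps] bounds [eps ln mu (A)] by [- nu (h - m)] and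
[eps ln mu (U)] by [- nu (c - m)], up to an arbitrarily small constant and a
term linear in [eps] ([gibbs_measure_le], [gibbs_measure_ge]); the latter
vanishes in the limit ([limf_esup_le_affine]).

The growth assumption enters through one inequality,
[1 + q ^+ 2 <= C * expR (2 * V q)] ([coercive_expR]). It dominates
[exp (- H)] by a constant times [1 / ((1 + p ^+ 2) * (1 + q ^+ 2))], which is
integrable; it bounds [V] from below; and it bounds the sublevel sets of [H],
which makes the rate function good. *)

(** * Monotonicity and exponential bounds for integrals *)

(** The integral of a nonnegative function is the supremum of the integrals of
the simple functions below it, and this family grows with the function. *)
Lemma le_integral_nonneg (d : measure_display) (T : measurableType d)
    (R : realType) (mu : {measure set T -> \bar R}) (f g : T -> \bar R) :
  (forall x, 0 <= f x)%E -> (forall x, f x <= g x)%E ->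
  (\int[mu]_x f x <= \int[mu]_x g x)%E.
Proof.
move=> f0 fg.
have g0 x : (0 <= g x)%E by apply: le_trans (f0 x) (fg x).
rewrite !ge0_integralTE//; apply: ereal_sup_le => _ [h hf <-].
by exists h => // x; apply: le_trans (hf x) (fg x).
Qed.

Section laplace_bounds.
Context {d : measure_display} {T : measurableType d} {R : realType}.
Variable mu : {measure set T -> \bar R}.
Variable H : T -> R.
Local Open Scope ereal_scope.

(** One unit of [beta] is set aside to keep the integrand integrable; the
remaining [beta - 1] units give the exponential rate. *)
Lemma integral_expR_le (A : set T) (h beta : R) :
  measurable_fun setT H -> (1 <= beta)%R -> (forall z, A z -> (h <= H z)%R) ->
  \int[mu]_(z in A) (expR (- beta * H z))%:E <=
  (expR (- (beta - 1) * h))%:E * \int[mu]_z (expR (- H z))%:E.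
Proof.
move=> mH beta1 hA; rewrite integral_mkcond -ge0_integralZl//; last first.
- apply/measurable_EFinP; apply: measurableT_comp => //.
  by apply: measurableT_comp => //; exact: mH.
apply: le_integral_nonneg => z; rewrite patchE.
  by case: ifPn => _ //; rewrite lee_fin expR_ge0.
case: ifPn => [/set_mem Az|_]; last by rewrite mule_ge0// lee_fin expR_ge0.
rewrite -EFinM lee_fin -expRD ler_expR.
have := hA _ Az; have : (0 <= beta - 1)%R by rewrite subr_ge0.
nra.
Qed.

Lemma integral_expR_ge (A B : set T) (c beta : R) :
  measurable B -> B `<=` A -> (0 <= beta)%R ->
  (forall z, B z -> (H z <= c)%R) ->
  (expR (- beta * c))%:E * mu B <= \int[mu]_(z in A) (expR (- beta * H z))%:E.
Proof.
move=> mB BA beta0 cB; rewrite -integral_cst//.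
rewrite [leLHS]integral_mkcond [leRHS]integral_mkcond.
apply: le_integral_nonneg => z; rewrite !patchE.
  by case: ifPn => _ //; rewrite lee_fin expR_ge0.
case: ifPn => [/set_mem Bz|_]; last first.
  by case: ifPn => _ //; rewrite lee_fin expR_ge0.
rewrite mem_set; last exact: BA.
by rewrite lee_fin ler_expR; have := cB _ Bz; nra.
Qed.

End laplace_bounds.

(** * Growth of the potential *)

(** Far away, [2 * V q >= 2 * eta * `|q| `^ alpha], and a single term of the
exponential series, of degree at least [2 / alpha], already exceeds a multiple
of [q ^+ 2]. On the remaining segment [V] is bounded below by continuity. *)
Lemma coercive_expR (R : realType) (V : R -> R) : continuous V ->
  (exists eta alpha L0 : R, [/\ 0 < eta, 0 < alpha, 1 <= L0 &
       forall q : R, L0 <= `|q| -> eta * `|q| `^ alpha <= V q]) ->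
  exists2 C : R, 0 < C & forall q, 1 + q ^+ 2 <= C * expR (2 * V q).
Proof.
move=> cV [eta [alpha [L0 [eta0 alpha0 L01 VL]]]].
have [c _ Vc] : exists2 c : R, c \in `[- L0, L0] &
    forall t : R, t \in `[- L0, L0] -> V c <= V t.
  by apply: EVT_min; [lra | exact: continuous_subspaceT].
pose n := Num.bound (2 / alpha).
have nalpha : 2 <= alpha * n.+1%:R.
  have : 2 / alpha < n%:R by apply: archi_boundP; rewrite divr_ge0// ltW.
  by rewrite ltr_pdivrMr// mulrC -natr1 => ?; nra.
pose k : R := (2 * eta) ^+ n.+1 / n.+1`!%:R.
have k0 : 0 < k by rewrite divr_gt0// exprn_gt0//; lra.
(* the first summand serves the tails, the second the segment *)
exists (2 / k + (1 + L0 ^+ 2) * expR (- (2 * V c))).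
  apply: addr_gt0; first exact: divr_gt0.
  by rewrite mulr_gt0 ?expR_gt0// ltr_wpDr// sqr_ge0.
move=> q; rewrite mulrDl -mulrA -expRD.
have kE : 0 <= 2 / k * expR (2 * V q).
  by rewrite mulr_ge0 ?expR_ge0// ltW// divr_gt0.
have cE : 0 <= (1 + L0 ^+ 2) * expR (- (2 * V c) + 2 * V q).
  by rewrite mulr_ge0 ?expR_ge0// addr_ge0// sqr_ge0.
have [qL|Lq] := lerP `|q| L0.
- rewrite -[leLHS]add0r lerD//.
  have q2 : q ^+ 2 <= L0 ^+ 2.
    by rewrite -(ger0_norm (sqr_ge0 q)) normrX ler_pXn2r// nnegrE; lra.
  have e1 : 1 <= expR (- (2 * V c) + 2 * V q).
    rewrite -[leLHS]expR0 ler_expR.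
    have : V c <= V q by apply: Vc; rewrite in_itv/= -ler_norml.
    lra.
  nra.
- rewrite -[leLHS]addr0 lerD//.
  rewrite mulrAC ler_pdivlMr//.
  have q1 : 1 <= `|q| by apply: le_trans L01 (ltW Lq).
  have x0 : 0 <= 2 * eta * `|q| `^ alpha by rewrite mulr_ge0 ?powR_ge0//; lra.
  have qn : `|q| ^+ 2 <= (`|q| `^ alpha) ^+ n.+1.
    rewrite -[leRHS]powR_mulrn ?powR_ge0// -powRrM -powR_mulrn//.
    exact: ler_powR.
  have kq : k * `|q| ^+ 2 <= expR (2 * V q).
    apply: (@le_trans _ _ (expR (2 * eta * `|q| `^ alpha))); last first.
      by rewrite ler_expR -mulrA ler_pM2l//; apply: VL; exact: ltW.
    apply: le_trans (expR_ge1Dxn n x0).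
    rewrite exprMn [X in _ <= 1 + X]mulrAC -/k.
    by apply: ler_wpDl => //; rewrite ler_pM2l.
  have : q ^+ 2 = `|q| ^+ 2 by rewrite -normrX ger0_norm// sqr_ge0.
  move=> ->; have : 1 <= `|q| ^+ 2 by rewrite exprn_ege1.
  nra.
Qed.

(** * Lebesgue measure on the plane *)

Section plane.
Context {R : realType}.
Notation mu := (@lebesgue_measure R \x @lebesgue_measure R)%E.

(** The area is written as an exponential since only its logarithm matters
later, and it must be positive and finite for that. *)
Lemma open_contains_box (U : set (R * R)) (z : R * R) : open U -> U z ->
  exists B l, [/\ measurable B, B `<=` U & mu B = (expR l)%:E].
Proof.
move=> oU Uz; have [[P Q] /= [/nbhs_ballP[r r0 rP] /nbhs_ballP[s s0 sQ]] PQU] :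
  nbhs z U by exact: open_nbhs_nbhs.
exists (ball z.1 r `*` ball z.2 s), (ln (r *+ 2 * (s *+ 2))); split.
- by apply: measurableX; exact: measurable_ball.
- by move=> w [w1 w2]; apply: PQU; split; [exact: rP|exact: sQ].
- rewrite product_measure1E; [|exact: measurable_ball..].
  transitivity ((r *+ 2)%:E * (s *+ 2)%:E)%E.
    by congr mule; apply: lebesgue_measure_ball; exact: ltW.
  by rewrite -EFinM lnK// posrE mulr_gt0// pmulrn_lgt0.
Qed.

Lemma measurable_oneDsqrV_prod : measurable_fun setT
  (fun z : R * R => ((oneDsqr z.1)^-1 * (oneDsqr z.2)^-1)%:E).
Proof.
have m1 : measurable_fun setT (fun x : R => (oneDsqr x)^-1).
  by apply: continuous_measurable_fun; exact: continuous_oneDsqrV.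
by apply/measurable_EFinP; apply: measurable_funM; exact: (measurableT_comp m1).
Qed.

Lemma integral_oneDsqrV :
  (\int[@lebesgue_measure R]_x ((oneDsqr x)^-1)%:E = pi%:E)%E.
Proof.
rewrite ge0_symfun_integralT; first last.
- by move=> x /=; rewrite /oneDsqr sqrrN.
- exact: continuous_oneDsqrV.
- by move=> x; rewrite invr_ge0 addr_ge0// sqr_ge0.
rewrite -set_itvcy integral0y_oneDsqr -EFinM; congr _%:E.
by rewrite mulrCA divff ?mulr1// pnatr_eq0.
Qed.

Lemma integral_oneDsqrV_prod :
  (\int[mu]_z ((oneDsqr z.1)^-1 * (oneDsqr z.2)^-1)%:E = (pi ^+ 2)%:E)%E.
Proof.
have ge0 (x : R) : 0 <= (oneDsqr x)^-1 by rewrite invr_ge0 addr_ge0// sqr_ge0.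
have mE : measurable_fun setT (fun x : R => ((oneDsqr x)^-1)%:E).
  apply/measurable_EFinP; apply: continuous_measurable_fun.
  exact: continuous_oneDsqrV.
rewrite fubini_tonelli1; last 2 first.
- exact: measurable_oneDsqrV_prod.
- by move=> z; rewrite lee_fin mulr_ge0.
rewrite /fubini_F/=.
under eq_integral => x _.
  under eq_integral do rewrite EFinM.
  rewrite ge0_integralZl//.
  rewrite integral_oneDsqrV; over.
rewrite ge0_integralZr//; last by rewrite lee_fin pi_ge0.
by rewrite integral_oneDsqrV -EFinM expr2.
Qed.

End plane.

(** * Logarithms of quotients and superior limits *)

Lemma lne_le_expR (R : realType) (x : \bar R) (s : R) :
  (x <= (expR s)%:E)%E -> (lne x <= s%:E)%E.
Proof.
case: x => [r|//|_]; last by rewrite leNye.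
rewrite lee_fin => rs; have [r0|r0] := lerP r 0.
  by rewrite le0_lneNy ?leNye// lee_fin.
by rewrite lne_EFin// lee_fin -ler_expR lnK.
Qed.

Lemma lne_ge_expR (R : realType) (x : \bar R) (s : R) :
  ((expR s)%:E <= x)%E -> (s%:E <= lne x)%E.
Proof.
case: x => [r|_|//]; last by rewrite leey.
rewrite lee_fin => rs; have r0 : 0 < r by apply: lt_le_trans (expR_gt0 s) rs.
by rewrite lne_EFin// lee_fin -ler_expR lnK.
Qed.

Lemma div_expR_le (R : realType) (x y : \bar R) (a b : R) :
  (0 <= x)%E -> y \is a fin_num ->
  (x <= (expR a)%:E)%E -> ((expR b)%:E <= y)%E ->
  (x / y <= (expR (a - b))%:E)%E.
Proof.
case: x y => [x| |] [y| |] //; rewrite !lee_fin => x0 _ xa yb.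
have y0 : 0 < y by apply: lt_le_trans (expR_gt0 b) yb.
rewrite inver gt_eqF// -EFinM lee_fin ler_pdivrMr// expRD expRN.
apply: (le_trans xa); rewrite -mulrA ler_peMr ?expR_ge0//.
by rewrite mulrC ler_pdivlMr ?expR_gt0// mul1r.
Qed.

Lemma div_expR_ge (R : realType) (x y : \bar R) (a b : R) :
  (0 < y)%E ->
  ((expR a)%:E <= x)%E -> (y <= (expR b)%:E)%E ->
  ((expR (a - b))%:E <= x / y)%E.
Proof.
case: y => [y| |] // y0 ax; rewrite lee_fin => yb; rewrite lte_fin in y0.
rewrite inver gt_eqF// lee_pdivlMr//; apply: le_trans ax.
rewrite -EFinM lee_fin expRD expRN -mulrA ler_piMr ?expR_ge0//.
by rewrite mulrC ler_pdivrMr ?expR_gt0// mul1r.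
Qed.

(** First choose [delta] so that [c * delta] is half of the tolerance, then
restrict to [eps] so small that [eps * K] is at most the other half. *)
Lemma limf_esup_le_affine (R : realType) (f : R -> \bar R) (a e c : R) :
  0 < e -> 0 < c ->
  (forall delta, 0 < delta -> exists K, forall eps, 0 < eps <= e ->
     (f eps <= (a + c * delta + eps * K)%:E)%E) ->
  (limf_esup f (0:R)^'+ <= a%:E)%E.
Proof.
move=> e0 c0 H; apply/lee_addgt0Pr => t t0; rewrite limf_esupE.
have [K HK] := H (t / (2 * c)) ltac:(by rewrite divr_gt0// mulr_gt0).
pose b := t / (2 * (1 + `|K|)).
have K0 : 0 < 1 + `|K| by rewrite ltr_wpDr.
have b0 : 0 < b by rewrite divr_gt0// mulr_gt0.
apply: ge_ereal_inf.
exists (ereal_sup (f @` [set x | 0 < x <= Num.min e b])).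
  exists [set x | 0 < x <= Num.min e b] => //=.
  near=> x; apply/andP; split => //.
  by near: x; apply: nbhs_right_ltW; rewrite lt_min e0 b0.
apply: ge_ereal_sup => _ [x /= /andP[x0 +] <-]; rewrite le_min => /andP[xe xb].
apply: le_trans (HK x _) _; first by rewrite x0.
rewrite -EFinD lee_fin -addrA lerD2l.
have -> : c * (t / (2 * c)) = t / 2 by field; rewrite gt_eqF.
have xK : x * K <= b * (1 + `|K|).
  have := ler_norm K; have := normr_ge0 K; nra.
suff : b * (1 + `|K|) = t / 2 by lra.
by rewrite /b; field; rewrite gt_eqF.
Unshelve. all: by end_near. Qed.

(** * Energy and its sublevel sets *)

Section energy.
Context {R : realType} (V : R -> R).
Notation mu := (@lebesgue_measure R \x @lebesgue_measure R)%E.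
Hypothesis cV : continuous V.
Variable C : R.
Hypothesis C0 : 0 < C.
(* the conclusion of [coercive_expR] *)
Hypothesis VC : forall q, 1 + q ^+ 2 <= C * expR (2 * V q).

Lemma continuous_energy : continuous (energy V).
Proof.
move=> z; apply: cvgD.
- apply: (@cvg_comp _ _ _ fst (fun x : R => x ^+ 2)); first exact: cvg_fst.
  exact: exprn_continuous.
- apply: cvgM; first exact: cvg_cst.
  by apply: (@cvg_comp _ _ _ snd V); [exact: cvg_snd|exact: cV].
Qed.

Lemma measurable_energy : measurable_fun setT (energy V).
Proof.
have mV := continuous_measurable_fun cV.
apply: measurable_funD.
- exact: measurable_funX.
- by apply: measurable_funM => //; exact: (measurableT_comp mV).
Qed.

(** The integrand is at most [C / ((1 + p ^+ 2) * (1 + q ^+ 2))]: use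
[exp (p ^+ 2) >= 1 + p ^+ 2] for the kinetic part and [VC] for the
potential. *)
Lemma integral_expR_energy_fin :
  exists k, (\int[mu]_z (expR (- energy V z))%:E <= (expR k)%:E)%E.
Proof.
have s0 (x : R) : 0 < oneDsqr x by rewrite ltr_wpDr// sqr_ge0.
exists (ln (C * pi ^+ 2)); rewrite lnK ?posrE ?mulr_gt0 ?exprn_gt0 ?pi_gt0//.
rewrite EFinM -integral_oneDsqrV_prod -ge0_integralZl//; last 2 first.
- exact: measurable_oneDsqrV_prod.
- by rewrite lee_fin ltW.
apply: le_integral_nonneg => z; first by rewrite lee_fin expR_ge0.
rewrite -EFinM lee_fin /energy opprD expRD mulrCA ler_pM ?expR_ge0//.
- by rewrite expRN lef_pV2 ?posrE ?expR_gt0//; exact: expR_ge1Dx.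
- rewrite expRN ler_pdivlMr// mulrC ler_pdivrMr ?expR_gt0//; exact: VC.
Qed.

Lemma has_lbound_potential : has_lbound (range V).
Proof.
exists (- ln C / 2) => _ [q _ <-].
have : 1 <= C * expR (2 * V q) by apply: le_trans (VC q); rewrite lerDl sqr_ge0.
move=> h; rewrite ler_pdivrMr// -ler_expR expRN lnK ?posrE//.
rewrite invf_ple ?posrE ?expR_gt0// (mulrC (V q)).
by rewrite -[leLHS]mul1r ler_pdivrMr// expR_gt0.
Qed.

Lemma energy_ge z : - Z0 V <= energy V z.
Proof.
have : inf (range V) <= V z.2.
  by apply: ge_inf; [exact: has_lbound_potential|exists z.2].
rewrite /Z0 /energy; have := sqr_ge0 z.1; lra.
Qed.

Lemma energy_near_min (delta : R) : 0 < delta ->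
  exists z, energy V z < - Z0 V + delta.
Proof.
move=> d0; have d2 : 0 < delta / 2 by rewrite divr_gt0.
have hi : has_inf (range V).
  by split; [exists (V 0), 0|exact: has_lbound_potential].
have [_ [q _ <-] qd] := inf_adherent d2 hi.
by exists (0, q); rewrite /energy /Z0 /= expr0n/=; lra.
Qed.

(** On a sublevel set the lower bound on [V] controls the momentum, and the
nonnegativity of the kinetic part leaves an upper bound on [V], hence by [VC]
on the position. *)
Lemma compact_energy_le (a : R) : compact [set z | energy V z <= a].
Proof.
have norm_le1D (x : R) : `|x| <= 1 + x ^+ 2.
  by rewrite -real_normK ?num_real//; have := normr_ge0 x; nra.
pose r := 1 + (a + Z0 V); pose s := 1 + C * expR a.
apply: (@subclosed_compact _ _ (`[- r, r] `*` `[- s, s])).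
- apply: (preimage_closed (f := energy V) (D := [set x | x <= a])).
    by move=> z _; exact: continuous_energy.
  exact: closed_le.
- by apply: compact_setX; exact: segment_compact.
- move=> z /= za; rewrite !in_itv/= -!ler_norml.
  have := energy_ge (0, z.2); move: (za); rewrite /energy /= expr0n /=.
  move=> za' m2; split.
    by apply: le_trans (norm_le1D _) _; rewrite /r; lra.
  apply: le_trans (norm_le1D _) _; apply: le_trans (VC _) _.
  rewrite -[leLHS]add0r lerD// ler_pM2l// ler_expR.
  by have := sqr_ge0 z.1; lra.
Qed.

(** * Exponential bounds for the Gibbs measures *)

Lemma gibbs_massE (nu eps : R) (A : set (R * R)) :
  gibbs_mass V nu eps A =
  (\int[mu]_(z in A) (expR (- (nu / eps) * energy V z))%:E)%E.
Proof.
apply: eq_integral => z _; congr (expR _)%:E.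
by rewrite /energy; move: (eps^-1) => x; field.
Qed.

Variable nu : R.
Hypothesis nu0 : 0 < nu.

Lemma gibbs_mass_le : exists k, forall (A : set (R * R)) (h : R),
  (forall z, A z -> h <= energy V z) -> forall eps, 0 < eps <= nu ->
  (gibbs_mass V nu eps A <= (expR (- (nu / eps - 1) * h + k))%:E)%E.
Proof.
have [k hk] := integral_expR_energy_fin; exists k => A h hA eps /andP[e0 enu].
rewrite gibbs_massE expRD EFinM.
have beta1 : 1 <= nu / eps by rewrite ler_pdivlMr// mul1r.
have := integral_expR_le mu measurable_energy beta1 hA.
move=> /le_trans; apply.
by rewrite lee_pmul2l// lte_fin expR_gt0.
Qed.

Lemma gibbs_mass_ge (U : set (R * R)) (z : R * R) (c : R) :
  open U -> U z -> energy V z < c -> exists l, forall eps, 0 < eps ->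
  ((expR (- (nu / eps) * c + l))%:E <= gibbs_mass V nu eps U)%E.
Proof.
move=> oU Uz zc.
have oW : open (U `&` [set w | energy V w < c]).
  apply: openI => //; apply: (open_comp (f := energy V) (D := [set x | x < c])).
    by move=> w _; exact: continuous_energy.
  exact: open_lt.
have [B [l [mB BW muB]]] := open_contains_box oW (conj Uz zc : (_ `&` _) z).
exists l => eps e0; rewrite gibbs_massE expRD EFinM -muB.
apply: integral_expR_ge => //.
- by move=> w /BW[].
- by rewrite ltW// divr_gt0.
- by move=> w /BW[_ /ltW].
Qed.

Lemma gibbs_mass_fin eps : 0 < eps <= nu ->
  gibbs_mass V nu eps setT \is a fin_num.
Proof.
have [k hk] := gibbs_mass_le => he.
rewrite ge0_fin_numE; last first.
  by apply: integral_ge0 => z _; rewrite lee_fin expR_ge0.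
exact: le_lt_trans (hk setT _ (fun z _ => energy_ge z) _ he) (ltry _).
Qed.

(** Upper bound on the mass of [A], and lower bound on the partition function
from a point at which the energy is almost minimal. *)
Lemma gibbs_measure_le (A : set (R * R)) (h delta : R) :
  (forall z, A z -> h <= energy V z) -> 0 < delta ->
  exists K, forall eps, 0 < eps <= nu ->
  (eps%:E * lne (gibbs_measure V nu eps A) <=
   (- (nu * (h + Z0 V)) + nu * delta + eps * K)%:E)%E.
Proof.
move=> hA d0; have [k hk] := gibbs_mass_le.
have [z zd] := energy_near_min d0.
have [l hl] := gibbs_mass_ge openT (I : setT z) zd.
exists (h + k - l) => eps he; have /andP[e0 enu] := he.
have Z_fin := gibbs_mass_fin he.
have mA0 : (0 <= gibbs_mass V nu eps A)%E.
  by apply: integral_ge0 => w _; rewrite lee_fin expR_ge0.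
have /lne_le_expR := div_expR_le mA0 Z_fin (hk A h hA eps he) (hl eps e0).
rewrite -(lee_pmul2l (x := eps%:E))// => /le_trans; apply.
rewrite -EFinM lee_fin le_eqVlt; apply/orP; left; apply/eqP; field.
by rewrite gt_eqF.
Qed.

(** Lower bound on the mass of [U] near [z], and upper bound on the partition
function from the lower bound [- Z0 V] on the energy. *)
Lemma gibbs_measure_ge (U : set (R * R)) (z : R * R) (delta : R) :
  open U -> U z -> 0 < delta ->
  exists K, forall eps, 0 < eps <= nu ->
  ((- (nu * (energy V z + Z0 V)) - nu * delta - eps * K)%:E <=
   eps%:E * lne (gibbs_measure V nu eps U))%E.
Proof.
move=> oU Uz d0; have [k hk] := gibbs_mass_le.
have zd : energy V z < energy V z + delta by rewrite ltrDl.
have [l hl] := gibbs_mass_ge oU Uz zd.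
have [l' hl'] := gibbs_mass_ge openT (I : setT z) zd.
exists (- Z0 V + k - l) => eps he; have /andP[e0 enu] := he.
have Z_gt0 : (0 < gibbs_mass V nu eps setT)%E.
  by apply: lt_le_trans (hl' eps e0); rewrite lte_fin expR_gt0.
have /lne_ge_expR := div_expR_ge Z_gt0 (hl eps e0)
  (hk setT _ (fun w _ => energy_ge w) eps he).
rewrite -(lee_pmul2l (x := eps%:E))//; apply: le_trans.
rewrite -EFinM lee_fin le_eqVlt; apply/orP; left; apply/eqP; field.
by rewrite gt_eqF.
Qed.

End energy.

(** * The large deviations principle *)

Theorem theorem3p3 (R : realType) (V : R -> R) (smoothV : smooth V)
    (growthV : exists eta alpha L0 : R, [/\ 0 < eta, 0 < alpha, 1 <= L0 &
       forall q : R, L0 <= `|q| -> eta * `|q| `^ alpha <= V q])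
    (nu : R) (nu_gt0 : 0 < nu) :
  satisfies_LDP (gibbs_measure V nu)
    (fun z : R * R => (nu * (energy V z + Z0 V))%:E).
Proof.
have cV : continuous V.
  move=> x; apply/differentiable_continuous/derivable1_diffP.
  exact: (smoothV 0%N).
have [C C0 VC] := coercive_expR cV growthV.
split.
- split; last first.
    move=> a a0.
    rewrite (_ : [set _ | _] = [set z | energy V z <= a / nu - Z0 V]).
      exact: compact_energy_le VC _.
    by apply/funext => z /=; rewrite lee_fin lerBrDr ler_pdivlMr// mulrC.
  split=> [z|].
    rewrite lee_fin mulr_ge0 ?(ltW nu_gt0)// -lerBlDr sub0r.
    exact: energy_ge C0 VC _.
  apply/lower_semicontinuousP => a.
  rewrite (_ : [set _ | _] = energy V @^-1` [set x | a / nu - Z0 V < x]).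
    apply: (open_comp (f := energy V)); last exact: open_gt.
    by move=> z _; exact: continuous_energy.
  by apply/funext => z /=; rewrite lte_fin ltrBlDr ltr_pdivrMr// mulrC.
- move=> U oU; rewrite leeNl; apply: le_ereal_inf_tmp => _ [z Uz <-].
  rewrite /limf_einf oppeK; apply: (limf_esup_le_affine nu_gt0 nu_gt0) => d d0.
  have [K hK] := gibbs_measure_ge cV C0 VC nu_gt0 oU Uz d0.
  exists K => eps he; rewrite leeNl; apply: le_trans (hK eps he).
  by rewrite -EFinN lee_fin; lra.
- move=> A _.
  (* comparing with real [t] below the infimum also covers an infinite
     infimum, which occurs when [A] is empty *)
  suff H (t : R) :
      (t%:E <= ereal_inf [set (nu * (energy V z + Z0 V))%:E | z in A])%E ->
      (limf_esup (fun eps : R => eps%:E * lne (gibbs_measure V nu eps A))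
         (0:R)^'+ <= (- t)%:E)%E.
    move: H; case: ereal_inf => [r| |] H.
    + exact: H.
    + rewrite -[leLHS]oppeK leeNl leye_eq; apply/eqP/eqyP => r _.
      by rewrite leeNr -EFinN; apply: H; rewrite leey.
    + by rewrite leey.
  move=> tA; apply: (limf_esup_le_affine nu_gt0 nu_gt0) => d d0.
  have hA z : A z -> t / nu - Z0 V <= energy V z.
    move=> Az; rewrite lerBlDr ler_pdivrMr// mulrC -lee_fin.
    by apply: le_trans tA _; apply: ereal_inf_lbound; exists z.
  have [K hK] := gibbs_measure_le cV C0 VC nu_gt0 hA d0.
  exists K => eps he; apply: le_trans (hK eps he) _.
  by rewrite subrK mulrCA divff ?gt_eqF// mulr1.
Qed.
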